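(* The free idempotent generated semigroup $\operatorname{IG}(Y)$ over a semilattice $Y$ is an abundant semigroup.
   Context: A semilattice is a commutative semigroup of idempotents, ordered by $e\leq f$ iff $ef=e$. A pair $(e,f)\in Y\times Y$ is basic if $\{e,f\}\cap\{ef,fe\}\neq\emptyset$. The free idempotent generated semigroup over $Y$ is given by the presentation $\operatorname{IG}(Y)=\langle \overline{Y} : \overline{e}\,\overline{f}=\overline{ef},\ (e,f)\text{ a basic pair}\rangle$ (as a semigroup), where $\overline{Y}=\{\overline{e}:e\in Y\}$ is a set of symbols in bijection with $Y$. For a semigroup $S$: $a\,\mathcal L^*\,b$ iff for all $x,y\in S^1$, $ax=ay\Leftrightarrow bx=by$; $a\,\mathcal R^*\,b$ iff for all $x,y\in S^1$, $xa=ya\Leftrightarrow xb=yb$. $S$ is abundant if each $\mathcal L^*$-class and each $\mathcal R^*$-class contains an idempotent. *)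

(* Defs.v *)
From HB Require Import structures.
From mathcomp Require Import all_boot.
From mathcomp Require Import boolp classical_sets.

Set Implicit Arguments.
Unset Strict Implicit.
Unset Printing Implicit Defensive.

Import Algebra.
Local Open Scope classical_set_scope.
Local Open Scope quotient_scope.
Local Open Scope group_scope.

(* Semigroups have no identity here, so only nonempty words are allowed. *)
Definition free_semigroup (X : choiceType) : Type := {w : seq X | w != [::]}.

Section FreeSemigroup.
Variable X : choiceType.
Implicit Types u v w : free_semigroup X.

HB.instance Definition _ := Choice.on (free_semigroup X).

Fact word_cat_subproof u v : val u ++ val v != [::].
Proof. by case: u => -[]. Qed.

Definition word_cat u v : free_semigroup X :=
  exist _ (val u ++ val v) (word_cat_subproof u v).

Fact word_catA : associative word_cat.
Proof. by move=> u v w; apply: val_inj; rewrite /= catA. Qed.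

HB.instance Definition _ := isSemigroup.Build (free_semigroup X) word_catA.

Definition letter (x : X) : free_semigroup X := exist _ [:: x] isT.

End FreeSemigroup.

(* The least congruence on [S] containing [r]. *)
Inductive congruence_closure (S : semigroupType) (r : S -> S -> Prop) :
    S -> S -> Prop :=
| cc_base a b : r a b -> congruence_closure r a b
| cc_refl a : congruence_closure r a a
| cc_sym a b : congruence_closure r a b -> congruence_closure r b a
| cc_trans b a c :
    congruence_closure r a b -> congruence_closure r b c ->
    congruence_closure r a c
| cc_mul a b c d :
    congruence_closure r a b -> congruence_closure r c d ->
    congruence_closure r (a * c) (b * d).

Section Quotient.
Variables (S : semigroupType) (r : S -> S -> Prop).

Definition congr_rel : rel S := fun a b => `[< congruence_closure r a b >].

Fact congr_rel_refl : reflexive congr_rel.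
Proof. by move=> a; apply/asboolP; apply: cc_refl. Qed.

Fact congr_rel_sym : symmetric congr_rel.
Proof. by move=> a b; apply/asboolP/asboolP; apply: cc_sym. Qed.

Fact congr_rel_trans : transitive congr_rel.
Proof.
by move=> b a c /asboolP ab /asboolP bc; apply/asboolP; apply: cc_trans bc.
Qed.

Canonical congr_equiv_rel :=
  EquivRel congr_rel congr_rel_refl congr_rel_sym congr_rel_trans.

Definition semigroup_quot : Type := {eq_quot congr_rel}.

HB.instance Definition _ := Choice.on semigroup_quot.
HB.instance Definition _ := EqQuotient.on semigroup_quot.

Definition quot_mul := lift_op2 semigroup_quot (@mul S).

Fact pi_quot_mul : {morph \pi_semigroup_quot : a b / a * b >-> quot_mul a b}.
Proof.
move=> a b; unlock quot_mul; apply/eqmodP/asboolP.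
by apply: cc_mul; apply/asboolP; rewrite -/(congr_rel _ _) -(eqmodE congr_equiv_rel) reprK.
Qed.

Fact quot_mulA : associative quot_mul.
Proof.
move=> p q s; rewrite -[p]reprK -[q]reprK -[s]reprK.
by rewrite -!pi_quot_mul mulgA.
Qed.

HB.instance Definition _ := isSemigroup.Build semigroup_quot quot_mulA.

End Quotient.

Section IG.
Variable Y : semigroupType.

Definition basic_pair (e f : Y) : Prop :=
  [set e; f] `&` [set e * f; f * e] !=set0.

Inductive IG_relations : free_semigroup Y -> free_semigroup Y -> Prop :=
| IG_relation e f : basic_pair e f ->
    IG_relations (letter e * letter f) (letter (e * f)).

Definition IG : Type := semigroup_quot IG_relations.

HB.instance Definition _ := Semigroup.on IG.

End IG.

Definition is_semilattice (Y : semigroupType) : Prop :=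
  commutative (@mul Y) /\ idempotent_op (@mul Y).

Section Abundant.
Variable S : semigroupType.

(* [option S] stands for S^1, with [None] the identity. If [S] already has an
   identity, then S^1 = S and [None] is merely a second name for it: it
   multiplies elements of [S] in the same way. *)
Definition rmul1 (a : S) (x : option S) : S := if x is Some b then a * b else a.
Definition lmul1 (x : option S) (a : S) : S := if x is Some b then b * a else a.

Definition Lstar (a b : S) : Prop :=
  forall x y : option S, rmul1 a x = rmul1 a y <-> rmul1 b x = rmul1 b y.

Definition Rstar (a b : S) : Prop :=
  forall x y : option S, lmul1 x a = lmul1 y a <-> lmul1 x b = lmul1 y b.

Definition abundant : Prop :=
  (forall a, exists2 e : S, e * e = e & Lstar a e) /\
  (forall a, exists2 e : S, e * e = e & Rstar a e).

End Abundant.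

(* Main.v *)
(** Since basic pairs in a semilattice are the comparable ones, the defining
    relations of IG(Y) rewrite [e f] to the smaller of [e] and [f] whenever
    they are comparable; the normal forms are the words whose adjacent letters
    are incomparable.  Let [e1 ... en] be the normal form of [a].  A normal form
    of [x e1] ends in some letter below [e1], hence not above [e2]; so
    multiplying it by [e2] either leaves it unchanged or appends [e2], and the
    result ends in a letter below [e1] only in the first case.  So
    right multiplication by [e2], and then by [e3], ..., [en], is injective on
    the elements [x e1], that is, [a] is R*-related to [e1].  The statement for
    L* follows by reversing words. *)

Require Import Defs.
From mathcomp Require Import all_boot.
From mathcomp Require Import boolp.

Set Implicit Arguments.
Unset Strict Implicit.
Unset Printing Implicit Defensive.

Import Algebra.
Local Open Scope quotient_scope.
Local Open Scope group_scope.

(** * Generators of IG(Y) *)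

Section Generators.
Variable Y : semigroupType.
Implicit Types (e f : Y) (w : seq Y) (u v : free_semigroup Y) (x y : IG Y).

Definition bar e : IG Y := \pi_(IG Y) (letter e).

Lemma pi_word_mul u v : \pi_(IG Y) (u * v) = \pi_(IG Y) u * \pi_(IG Y) v.
Proof. exact: pi_quot_mul. Qed.

Lemma eq_pi_IG u v :
  \pi_(IG Y) u = \pi_(IG Y) v <-> congruence_closure (@IG_relations Y) u v.
Proof.
split=> [/eqmodP /asboolP // | cuv].
by apply/eqmodP/asboolP.
Qed.

Lemma bar_mul e f : basic_pair e f -> bar e * bar f = bar (e * f).
Proof. by move=> ef; rewrite -pi_word_mul; apply/eq_pi_IG/cc_base. Qed.

(** Generators are split off on the right, since a stack grows by the last letter of a word. *)
Lemma IG_ind (P : IG Y -> Prop) :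
  (forall e, P (bar e)) -> (forall x e, P x -> P (x * bar e)) ->
  forall x, P x.
Proof.
move=> P1 PM x; rewrite -[x]reprK; case: (repr x) => w.
elim/last_ind: w => [//|w e IHw] we_neq0.
have [w0|w_neq0] := eqVneq w [::].
  suff -> : exist _ (rcons w e) we_neq0 = letter e by apply: P1.
  by apply: val_inj; rewrite /= w0.
suff -> : exist _ (rcons w e) we_neq0 =
    (exist _ w w_neq0 : free_semigroup Y) * letter e.
  by rewrite pi_word_mul; apply: PM (IHw w_neq0).
by apply: val_inj; rewrite /= -cats1.
Qed.

End Generators.

(** * Reduction of words on a stack *)

Section NormalForms.
Variable Y : semigroupType.
Hypothesis hY : is_semilattice Y.
Implicit Types (e f : Y) (s t w : seq Y) (u v : free_semigroup Y).
Implicit Types (x y a : IG Y).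

Let mulYC : commutative (@mul Y) := hY.1.
Let mulYY : idempotent_op (@mul Y) := hY.2.

Definition below e f := e * f == e.
Definition incomparable e f := ~~ below e f && ~~ below f e.

Lemma below_refl e : below e e.
Proof. by rewrite /below mulYY. Qed.

Lemma below_trans : transitive below.
Proof. by move=> f e g /eqP ef /eqP fg; rewrite /below -ef -mulgA fg. Qed.

Lemma below_anti e f : below e f -> below f e -> e = f.
Proof. by move=> /eqP ef /eqP fe; rewrite -ef mulYC. Qed.

Lemma basic_pairE e f : basic_pair e f <-> below e f \/ below f e.
Proof.
rewrite /below (mulYC f e); split.
  by case=> z /= [] [] -> []; rewrite ?(mulYC f e) => <-; rewrite ?eqxx; auto.
by case=> /eqP ef; exists (e * f); split; [left| left|right|left].
Qed.

(* Words in normal form are stored as stacks, the last letter being at the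
   head; [push e s] is the normal form of the word [s] followed by [e]. *)
Fixpoint push s e :=
  if s is t :: s' then
    if below t e then s else if below e t then push s' e else e :: s
  else [:: e].

Definition top_below e s := if s is t :: _ then below t e else false.

Lemma top_below_push s e : top_below e (push s e).
Proof.
elim: s => [|t s IHs] /=; first exact: below_refl.
by case: ifP => // _; case: ifP => //= _; apply: below_refl.
Qed.

Lemma push_top_below s e : top_below e s -> push s e = s.
Proof. by case: s => //= t s ->. Qed.

(** This makes [push] respect the defining relations. If [e] is below [f], the top left by [e]
    already absorbs [f]; if [f] is strictly below [e], then [f] pops [e] and every letter that [e]
    pops. *)
Lemma push_push s e f : basic_pair e f -> push (push s e) f = push s (e * f).
Proof.
case/basic_pairE=> [ef|fe].
  rewrite (eqP ef) push_top_below //.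
  by have := top_below_push s e; case: (push s e) => //= t _ /below_trans->.
rewrite mulYC (eqP fe).
have [->|neq_ef] := eqVneq e f; first exact/push_top_below/top_below_push.
have nef : below e f = false.
  by apply: contra_neqF neq_ef => ef; apply: below_anti.
elim: s => [|t s IHs] /=; first by rewrite nef fe.
have [//|nte] := boolP (below t e).
have [et|net] := boolP (below e t); last by rewrite /= nef fe.
rewrite IHs (below_trans fe et) ifN //.
by apply: contra nte => tf; apply: below_trans fe.
Qed.

(** * The right action of IG(Y) on stacks *)

Lemma foldl_push_congr u v : congruence_closure (@IG_relations Y) u v ->
  forall s, foldl push s (val u) = foldl push s (val v).
Proof.
elim=> {u v} [_ _ [e f ef]|//|u v _ IH|v u w _ IHuv _ IHvw|u v u' v' _ IH _ IH'] s.
- exact: push_push.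
- by rewrite IH.
- by rewrite IHuv.
- by rewrite /= !foldl_cat IH IH'.
Qed.

Definition act s x := foldl push s (val (repr x)).

Lemma act_pi s u : act s (\pi_(IG Y) u) = foldl push s (val u).
Proof. by apply: foldl_push_congr; apply/eq_pi_IG; rewrite reprK. Qed.

Lemma act_bar s e : act s (bar e) = push s e.
Proof. exact: act_pi. Qed.

Lemma act_mul s x y : act s (x * y) = act (act s x) y.
Proof.
by rewrite -[x]reprK -[y]reprK -pi_word_mul !act_pi /= foldl_cat.
Qed.

(** Reads a stack back as a product, giving a left inverse of [act [::]]; the empty stack stands for
    the adjoined identity. *)
Fixpoint stack_val s : option (IG Y) :=
  if s is e :: s' then Some (lmul1 (stack_val s') (bar e)) else None.

Lemma stack_val_push s e :
  stack_val (push s e) = Some (lmul1 (stack_val s) (bar e)).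
Proof.
elim: s => [//|t s IHs] /=.
case: ifP => [te|_].
  have bte : bar t * bar e = bar t.
    by rewrite bar_mul ?(eqP te) //; apply/basic_pairE; left.
  by rewrite /=; case: (stack_val s) => [z|] /=; rewrite -?mulgA bte.
case: ifP => [et|//].
have bte : bar t * bar e = bar e.
  by rewrite bar_mul; [rewrite mulYC (eqP et) | apply/basic_pairE; right].
by rewrite IHs; case: (stack_val s) => [z|] /=; rewrite -?mulgA bte.
Qed.

Lemma stack_val_act x : stack_val (act [::] x) = Some x.
Proof.
elim/IG_ind: x => [e|x e IHx]; first by rewrite act_bar.
by rewrite act_mul act_bar stack_val_push IHx.
Qed.

Lemma act_nil_inj : injective (act [::]).
Proof. by move=> x y exy; apply: Some_inj; rewrite -!stack_val_act exy. Qed.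

Lemma sorted_push s e : sorted incomparable s -> sorted incomparable (push s e).
Proof.
elim: s => [//|t s IHs] /= ts; case: ifP => // nte.
case: ifP => [_|net]; first exact/IHs/(path_sorted ts).
by rewrite /= /incomparable nte net.
Qed.

Lemma sorted_act x : sorted incomparable (act [::] x).
Proof.
elim/IG_ind: x => [e|x e]; first by rewrite act_bar.
by rewrite act_mul act_bar; apply: sorted_push.
Qed.

(** * Cancellation and R*-classes *)

Lemma incomparable_sym : symmetric incomparable.
Proof. by move=> e f; rewrite /incomparable andbC. Qed.

Lemma act_normal_form s x : act s x = foldl push s (rev (act [::] x)).
Proof.
suff E t z : stack_val t = Some z -> act s z = foldl push s (rev t).
  exact/E/stack_val_act.
elim: t z => [//|e t IHt] /= _ [<-]; rewrite rev_cons foldl_rcons.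
case: t IHt => [_|f t IHt]; first exact: act_bar.
by rewrite act_mul act_bar -(IHt _ erefl).
Qed.

Lemma push_inj e f s t : incomparable e f -> top_below e s -> top_below e t ->
  push s f = push t f -> s = t.
Proof.
move=> /andP[nef nfe]; case: s t => [|g s] [|h t] //= ge he.
(* Hence pushing [f] pops nothing from either stack. *)
have above k : below k e -> below f k = false.
  by move=> ke; apply: contraNF nfe => fk; apply: below_trans ke.
rewrite !above //; case: ifP => _; case: ifP => _ //.
(* When only one stack grows, [f] is the top of the other and so lies below [e]. *)
- by case=> gf _; rewrite -gf ge in nfe.
- by case=> hf _; rewrite hf he in nfe.
- by case=> -> ->.
Qed.

(** After [f] is pushed both tops lie below [f], so [f] takes over the role of [e]. *)
Lemma foldl_push_inj e w s t : path incomparable e w ->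
  top_below e s -> top_below e t -> foldl push s w = foldl push t w -> s = t.
Proof.
elim: w e s t => [//|f w IHw] e s t /= /andP[ef fw] se te.
move/(IHw _ _ _ fw (top_below_push s f) (top_below_push t f)).
exact: push_inj ef se te.
Qed.

Lemma Rstar_bar a : exists e, Rstar a (bar e).
Proof.
(* The identity of S^1 gets the empty stack, so that it needs no separate case. *)
pose stack (z : option (IG Y)) := if z is Some x then act [::] x else [::].
have actE z b : act [::] (lmul1 z b) = act (stack z) b.
  by case: z => [x|//]; rewrite act_mul.
have: sorted incomparable (rev (act [::] a)).
  rewrite rev_sorted (@eq_sorted _ _ incomparable) ?sorted_act // => e f.
  exact: incomparable_sym.
have := act_normal_form ^~ a; case: (rev _) => [act0|e w actE' ew].
  (* With an empty normal form [a] would fix the empty stack, which has no value in IG(Y). *)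
  by have := stack_val_act a; rewrite act0.
exists e => x y; split=> [exy|exy]; apply: act_nil_inj; rewrite !actE.
  move/(congr1 (act [::])): exy; rewrite !actE !actE' !act_bar /=.
  by apply: (foldl_push_inj ew); apply: top_below_push.
move/(congr1 (act [::])): exy; rewrite !actE !act_bar => exy.
by rewrite !actE' /= exy.
Qed.

Lemma bar_idem e : bar e * bar e = bar e.
Proof. by rewrite bar_mul ?mulYY //; apply/basic_pairE; left; exact: below_refl. Qed.

(** * Reversal of words and L*-classes *)

Fact word_rev_subproof u : rev (val u) != [::].
Proof. by rewrite -size_eq0 size_rev size_eq0; exact: (valP u). Qed.

Definition word_rev u : free_semigroup Y :=
  exist _ (rev (val u)) (word_rev_subproof u).

Lemma word_rev_mul u v : word_rev (u * v) = word_rev v * word_rev u.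
Proof. by apply: val_inj; rewrite /= rev_cat. Qed.

Lemma word_rev_letter e : word_rev (letter e) = letter e.
Proof. exact: val_inj. Qed.

(** Basic pairs are symmetric and [Y] is commutative, so reversing a defining relation gives another
    one; reversal thus descends to an anti-automorphism of IG(Y). *)
Lemma word_rev_congr u v : congruence_closure (@IG_relations Y) u v ->
  congruence_closure (@IG_relations Y) (word_rev u) (word_rev v).
Proof.
elim=> {u v} [_ _ [e f ef]|u|u v _|v u w _ IH _|u v u' v' _ IH _ IH'].
- rewrite word_rev_mul !word_rev_letter mulYC; apply/cc_base/IG_relation.
  by apply/basic_pairE/or_comm/basic_pairE.
- exact: cc_refl.
- exact: cc_sym.
- exact: cc_trans.
- by rewrite !word_rev_mul; apply: cc_mul.
Qed.

Definition IG_rev x : IG Y := \pi_(IG Y) (word_rev (repr x)).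

Lemma IG_rev_pi u : IG_rev (\pi_(IG Y) u) = \pi_(IG Y) (word_rev u).
Proof. by apply/eq_pi_IG/word_rev_congr/eq_pi_IG; rewrite reprK. Qed.

Lemma IG_rev_mul x y : IG_rev (x * y) = IG_rev y * IG_rev x.
Proof.
by rewrite -[x]reprK -[y]reprK -pi_word_mul !IG_rev_pi word_rev_mul pi_word_mul.
Qed.

Lemma IG_rev_bar e : IG_rev (bar e) = bar e.
Proof. by rewrite IG_rev_pi word_rev_letter. Qed.

Lemma IG_revK : involutive IG_rev.
Proof.
move=> x; rewrite -[x]reprK !IG_rev_pi; apply: congr1.
by apply: val_inj; rewrite /= revK reprK.
Qed.

Lemma Rstar_rev a b : Rstar (IG_rev a) (IG_rev b) -> Lstar a b.
Proof.
move=> Rab x y.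
have rmul1E c z : IG_rev (rmul1 c z) = lmul1 (omap IG_rev z) (IG_rev c).
  by case: z => [z|//]; apply: IG_rev_mul.
have eq_rev c : rmul1 c x = rmul1 c y <->
    lmul1 (omap IG_rev x) (IG_rev c) = lmul1 (omap IG_rev y) (IG_rev c).
  by rewrite -!rmul1E; split=> [->//|/(can_inj IG_revK)].
by rewrite !eq_rev; apply: Rab.
Qed.

Lemma Lstar_bar a : exists e, Lstar a (bar e).
Proof.
have [e Rae] := Rstar_bar (IG_rev a).
by exists e; apply: Rstar_rev; rewrite IG_rev_bar.
Qed.

End NormalForms.

Theorem proposition3p2 (Y : semigroupType) (hY : is_semilattice Y) :
  abundant (IG Y).
Proof.
split=> a.
  by have [e Lae] := Lstar_bar hY a; exists (bar e); first exact: bar_idem.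
by have [e Rae] := Rstar_bar hY a; exists (bar e); first exact: bar_idem.
Qed.
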